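(* Let $S$ be a semigroup and let $T$ be a subsemigroup of $S$. If $B$ is a generating set for $T$ and $C=\{h_i : i\in I\}$ is a set of representatives of the $T$-relative $\mathscr{H}$-classes contained in $S\setminus T$, then $B\cup C$ is a generating set for $S$. In particular, if $T$ is finitely generated and has finite Green index in $S$, then $S$ is finitely generated.
   Context: For a semigroup $S$, $S^1=S\cup\{1\}$ denotes $S$ with a new identity element $1\notin S$ adjoined; for $X\subseteq S$, $X^1=X\cup\{1\}$. For a subsemigroup $T$ of $S$ and $u,v\in S$: $u\,\mathscr{R}^T v$ iff $uT^1=vT^1$; $u\,\mathscr{L}^T v$ iff $T^1u=T^1v$; $\mathscr{H}^T=\mathscr{R}^T\cap\mathscr{L}^T$. Their classes are called $T$-relative $\mathscr{R}$-, $\mathscr{L}$- and $\mathscr{H}$-classes; each lies wholly in $T$ or wholly in $S\setminus T$. The Green index of $T$ in $S$ is one more than the number of $T$-relative $\mathscr{H}$-classes contained in $S\setminus T$. *)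

(* Defs.v *)
From HB Require Import structures.
From mathcomp Require Import all_boot.
From mathcomp Require Import all_classical.

Set Implicit Arguments.
Unset Strict Implicit.
Unset Printing Implicit Defensive.

Local Open Scope group_scope.
Local Open Scope classical_set_scope.
Local Open Scope card_scope.

(* S^1: a new identity [None] is adjoined even when S already has one. *)
Definition adjoin1 (S : Type) : Type := option S.

HB.instance Definition _ (S : choiceType) := Choice.on (adjoin1 S).

Section Adjoin1.
Variable S : semigroupType.

Definition adjoin1_mul (x y : adjoin1 S) : adjoin1 S :=
  match x, y with
  | Some a, Some b => Some (a * b)
  | Some a, None => Some a
  | None, _ => y
  end.

Lemma adjoin1_mulA : associative adjoin1_mul.
Proof. by case=> [a|] [b|] [c|] //=; rewrite mulgA. Qed.

Lemma adjoin1_mul1 : left_id None adjoin1_mul.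
Proof. by []. Qed.

Lemma adjoin1_mulr1 : right_id None adjoin1_mul.
Proof. by case. Qed.

HB.instance Definition _ := isMonoid.Build (adjoin1 S)
  adjoin1_mulA adjoin1_mul1 adjoin1_mulr1.

Definition to_adjoin1 (x : S) : adjoin1 S := Some x.

End Adjoin1.

Section RelativeGreen.
Variable S : semigroupType.
Implicit Types (T B C X : set S) (u v : S).

Definition subsemigroup T : Prop := mulg_closed (mem T).

Definition generated B : set S := smallest subsemigroup B.

Definition generating_set B T : Prop := generated B = T.

Definition finitely_generated T : Prop :=
  exists2 B : set S, finite_set B & generating_set B T.

Definition set_adjoin1 X : set (adjoin1 S) :=
  [set to_adjoin1 x | x in X] `|` [set 1].

Definition relR T u v : Prop :=
  [set to_adjoin1 u * t | t in set_adjoin1 T] =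
  [set to_adjoin1 v * t | t in set_adjoin1 T].

Definition relL T u v : Prop :=
  [set t * to_adjoin1 u | t in set_adjoin1 T] =
  [set t * to_adjoin1 v | t in set_adjoin1 T].

Definition relH T u v : Prop := relR T u v /\ relL T u v.

Definition Hclass T u : set S := [set v | relH T u v].

Definition outer_Hclasses T : set (set S) :=
  [set X | range (Hclass T) X /\ X `<=` ~` T].

Definition has_green_index T (n : nat) : Prop :=
  exists2 k : nat, outer_Hclasses T #= `I_k & n = k.+1.

Definition finite_green_index T : Prop := exists n, has_green_index T n.

Definition representatives T C : Prop :=
  (forall c, C c -> exists2 X, outer_Hclasses T X & X c) /\
  (forall X, outer_Hclasses T X -> exists! c, C c /\ X c).

End RelativeGreen.

(* Main.v *)
Require Import Defs.
From mathcomp Require Import all_boot.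
From mathcomp Require Import all_classical.

Local Open Scope classical_set_scope.

(** An element [s] outside [T] has its whole [T]-relative H-class outside [T],
    since [s \in v T^1] with [v \in T] would put [s] in [T].  A
    subsemigroup containing [T] and a point [c] of this class also contains [s],
    because [s] and [c] are R-related: [s = c] or [s = c * t] with [t \in T]
    ([relR_factor]).  Thus the generators of
    [T] together with any set meeting every outer H-class generate [S]
    ([generating_set_setU_meets]).  Sets of representatives are such sets; when
    there are finitely many outer classes, one point chosen in each gives a
    finite such set. *)

Lemma subset_generated (S : semigroupType) (B : set S) : B `<=` generated B.
Proof. exact: sub_gen_smallest. Qed.

Lemma generatedM (S : semigroupType) (B : set S) (x y : S) :
  generated B x -> generated B y -> generated B (x * y)%g.
Proof.
move=> Bx By A [mulA BA]; apply/set_mem/mulA; apply/mem_set.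
- exact: Bx.
- exact: By.
Qed.

Lemma generated_subset (S : semigroupType) (B C : set S) :
  B `<=` C -> generated B `<=` generated C.
Proof. by move=> BC x Bx A [mulA CA]; apply: Bx; split=> // y /BC /CA. Qed.

(** The element [u * 1] of [u T^1] must lie in [v T^1]; the adjoined identity
    accounts for the case [u = v]. *)
Lemma relR_factor (S : semigroupType) (T : set S) (u v : S) :
  relR T u v -> u = v \/ exists2 t, T t & u = (v * t)%g.
Proof.
rewrite /relR => uTvT.
have : [set to_adjoin1 u * t | t in set_adjoin1 T]%g (to_adjoin1 u).
  by exists 1%g; [right | rewrite mulg1].
rewrite uTvT => -[_ [[t Tt <-]|->]].
  by case=> <-; right; exists t.
by rewrite mulg1 => -[<-]; left.
Qed.

Lemma outer_Hclass (S : semigroupType) (T : set S) (s : S) :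
  subsemigroup T -> ~ T s -> outer_Hclasses T (Hclass T s).
Proof.
move=> mulT nTs; split; first by exists s.
move=> v [/relR_factor sv _] Tv; apply: nTs.
case: sv => [->//|[t Tt ->]].
by apply/set_mem/mulT; apply/mem_set.
Qed.

Lemma generating_set_setU_meets (S : semigroupType) (T B C : set S) :
  subsemigroup T -> generating_set B T ->
  (forall X, outer_Hclasses T X -> C `&` X !=set0) ->
  generating_set (B `|` C) [set: S].
Proof.
move=> mulT genB meetC; apply/seteqP; split=> // s _.
have genT : T `<=` generated (B `|` C).
  by rewrite -[X in X `<=` _]genB; apply: generated_subset => x; left.
have [/genT //|nTs] := pselect (T s).
have [c [Cc [/relR_factor sc _]]] := meetC _ (outer_Hclass _ _ _ mulT nTs).
have genc : generated (B `|` C) c by apply: subset_generated; right.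
by case: sc => [->//|[t /genT gent ->]]; apply: generatedM.
Qed.

Lemma outer_Hclasses_nonempty (S : semigroupType) (T X : set S) :
  outer_Hclasses T X -> X !=set0.
Proof. by case=> -[s _ <-] _; exists s. Qed.

(** Each set [X] is assigned a finite set [f X] rather than a point: the choice
    function has to be defined on every [X], including the empty set, and [U]
    itself may have no point to use as a default value. *)
Lemma finite_meets (U : Type) (F : set (set U)) :
  finite_set F -> (forall X, F X -> X !=set0) ->
  exists2 C : set U, finite_set C & forall X, F X -> C `&` X !=set0.
Proof.
move=> finF F0.
have /choice[f Hf] : forall X : set U,
    exists A : set U, finite_set A /\ (F X -> A `&` X !=set0).
  move=> X; have [/F0[x Xx]|nFX] := pselect (F X).
    by exists [set x]; split=> // _; exists x.
  by exists set0; split.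
exists (\bigcup_(X in F) f X).
  by apply: bigcup_finite => // X _; case: (Hf X).
move=> X FX; have [_ /(_ FX)[x [fx Xx]]] := Hf X.
by exists x; split=> //; exists X.
Qed.

Theorem theorem4p1 (S : semigroupType) (T : set S) (hT : subsemigroup T) :
  (forall (B : set S) (I : Type) (h : I -> S),
      generating_set B T ->
      representatives T (range h) ->
      generating_set (B `|` range h) [set: S]) /\
  (finitely_generated T -> finite_green_index T ->
      finitely_generated [set: S]).
Proof.
split=> [B I h genB [_ repr]|[B finB genB] [_ [k outer_k _]]].
  apply: (generating_set_setU_meets _ _ _ _ hT genB) => X /repr[c [[hc Xc] _]].
  by exists c.
have fin_outer : finite_set (outer_Hclasses T) by exists k.
have [C finC meetC] := finite_meets _ _ fin_outer (outer_Hclasses_nonempty S T).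
exists (B `|` C); first by rewrite finite_setU.
exact: (generating_set_setU_meets _ _ _ _ hT genB meetC).
Qed.
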